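(* Let $n,k$ be positive integers, where $n$ is even and $k<n/2$. Then the double generalized Petersen graph $\mathrm{DP}(n,k)$ is isomorphic to $\mathrm{DP}(n,n/2-k)$.
   Context: For integers $n\ge 3$ and $1\le k<n/2$, the double generalized Petersen graph $\mathrm{DP}(n,k)$ has vertex set $\{u_i,w_i,x_i,y_i : i=0,\dots,n-1\}$ and edge set consisting of the edges $u_iu_{i+1}$, $x_ix_{i+1}$, $w_iy_{i+k}$, $y_iw_{i+k}$, $u_iw_i$ and $x_iy_i$, for $i=0,\dots,n-1$, with subscripts taken modulo $n$. *)

(* Defs.v *)
From HB Require Import structures.
From mathcomp Require Import all_boot.

Set Implicit Arguments.
Unset Strict Implicit.
Unset Printing Implicit Defensive.

(* Finite simple graphs. *)
Record sgraph := SGraph {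
  vertex :> finType;
  adj : rel vertex;
  adj_sym : symmetric adj;
  adj_irr : irreflexive adj
}.

Definition isomorphic (G H : sgraph) : Prop :=
  exists2 f : G -> H, bijective f &
    forall a b : G, adj (f a) (f b) = adj a b.

Inductive DP_vertex (n : nat) : Type :=
  | U of 'I_n
  | W of 'I_n
  | X of 'I_n
  | Y of 'I_n.

Definition DP_encode (n : nat) (a : DP_vertex n) : ('I_n + 'I_n) + ('I_n + 'I_n) :=
  match a with
  | U i => inl (inl i)
  | W i => inl (inr i)
  | X i => inr (inl i)
  | Y i => inr (inr i)
  end.

Definition DP_decode (n : nat) (s : ('I_n + 'I_n) + ('I_n + 'I_n)) : DP_vertex n :=
  match s with
  | inl (inl i) => U i
  | inl (inr i) => W i
  | inr (inl i) => X i
  | inr (inr i) => Y i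
  end.

Lemma DP_encodeK (n : nat) : cancel (@DP_encode n) (@DP_decode n).
Proof. by case. Qed.

HB.instance Definition _ (n : nat) :=
  Finite.copy (DP_vertex n) (can_type (@DP_encodeK n)).

(* The edges as listed, each read in one direction: u_i u_{i+1}, x_i x_{i+1},
   w_i y_{i+k}, y_i w_{i+k}, u_i w_i, x_i y_i, with subscripts modulo n. *)
Definition DP_arc (n k : nat) (a b : DP_vertex n) : bool :=
  match a, b with
  | U i, U j | X i, X j => (j : nat) == (i + 1) %% n
  | W i, Y j | Y i, W j => (j : nat) == (i + k) %% n
  | U i, W j | X i, Y j => i == j
  | _, _ => false
  end.

(* The guard a != b only makes DP total: by DP_arc_irr and DP_adjE it is
   redundant as soon as 1 < n, hence whenever 3 <= n and 1 <= k < n/2. *)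
Definition DP_adj (n k : nat) : rel (DP_vertex n) :=
  fun a b => (a != b) && (DP_arc k a b || DP_arc k b a).

Lemma DP_adj_sym (n k : nat) : symmetric (@DP_adj n k).
Proof. by move=> a b; rewrite /DP_adj eq_sym orbC. Qed.

Lemma DP_adj_irr (n k : nat) : irreflexive (@DP_adj n k).
Proof. by move=> a; rewrite /DP_adj eqxx. Qed.

Definition DP (n k : nat) : sgraph := SGraph (@DP_adj_sym n k) (@DP_adj_irr n k).

Lemma DP_arc_irr (n k : nat) (n_gt1 : 1 < n) : irreflexive (@DP_arc n k).
Proof.
have neq (i : 'I_n) : ((i : nat) == (i + 1) %% n) = false.
  apply/negP => /eqP e.
  have: (i + 1 == i + 0 %[mod n]) by rewrite addn0 -e (modn_small (ltn_ord i)).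
  by rewrite eqn_modDl mod0n modn_small.
by case=> i //=; apply: neq.
Qed.

Lemma DP_adjE (n k : nat) (n_gt1 : 1 < n) (a b : DP n k) :
  adj a b = DP_arc k a b || DP_arc k b a.
Proof.
rewrite /= /DP_adj; case: eqVneq => [->|//].
by rewrite DP_arc_irr.
Qed.

(* Main.v *)
Require Import Defs.
From mathcomp Require Import all_boot.

(** Write [m = n/2]. Since [-(m - k) = m + k] modulo [n], in DP(n, m-k) the
    vertex [w_i] is adjacent to [y_(i+m-k)] and [y_(i+m+k)]. Rotating the [x]'s
    and [y]'s by [m] and fixing the [u]'s and [w]'s is therefore an isomorphism
    from DP(n,k). *)

Definition half_turn {n : nat} (i : 'I_n) : 'I_n :=
  Ordinal (ltn_pmod (i + n./2) (leq_ltn_trans (leq0n i) (ltn_ord i))).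

Definition turn_XY {n : nat} (a : DP_vertex n) : DP_vertex n :=
  match a with
  | U i => U i
  | W i => W i
  | X i => X (half_turn i)
  | Y i => Y (half_turn i)
  end.

Lemma half_turnK (n : nat) : ~~ odd n -> involutive (@half_turn n).
Proof.
move=> n_even i; apply: val_inj; have i_lt := ltn_ord i.
by rewrite /= modnDml -addnA addnn even_halfK // modnDr modn_small.
Qed.

Lemma turn_XYK (n : nat) : ~~ odd n -> involutive (@turn_XY n).
Proof. by move=> n_even [] i //=; rewrite half_turnK. Qed.

Lemma half_turn_addr (n c : nat) (i j : 'I_n) :
  ((half_turn j : nat) == (half_turn i + c) %% n) = ((j : nat) == (i + c) %% n).
Proof. by rewrite /= modnDml addnAC eqn_modDr (modn_small (ltn_ord j)). Qed.

(** Adding [k] to both sides undoes the truncated subtraction, and [n./2] then cancels. Arcs between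
    [W] and [Y] thus get reversed. *)
Lemma half_turn_arcl (n k : nat) (k_lt : k < n./2) (i j : 'I_n) :
  ((half_turn j : nat) == (i + (n./2 - k)) %% n) = ((i : nat) == (j + k) %% n).
Proof.
rewrite /= -(eqn_modDr k) -[i + _ + k]addnA subnK ?(ltnW k_lt) //.
by rewrite addnAC eqn_modDr (modn_small (ltn_ord i)) eq_sym.
Qed.

(** Follows from [half_turn_arcl] by a half turn of both sides, which is an involution for even
    [n]. *)
Lemma half_turn_arcr (n k : nat) (n_even : ~~ odd n) (k_lt : k < n./2)
    (i j : 'I_n) :
  ((i : nat) == (half_turn j + (n./2 - k)) %% n) = ((j : nat) == (i + k) %% n).
Proof. by rewrite -[RHS]half_turn_arcl // -[RHS]half_turn_addr half_turnK. Qed.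

Lemma turn_XY_arc (n k : nat) (n_even : ~~ odd n) (k_lt : k < n./2)
    (a b : DP_vertex n) :
  DP_arc (n./2 - k) (turn_XY a) (turn_XY b)
    || DP_arc (n./2 - k) (turn_XY b) (turn_XY a)
  = DP_arc k a b || DP_arc k b a.
Proof.
(* The cases left are, in order, [W]-[Y], [X]-[X], [X]-[Y], [Y]-[W] and [Y]-[X]; the reversal of
   arcs makes [orbC] necessary in the first and fourth. *)
case: a b => i [] j //.
- by rewrite /DP_arc /turn_XY half_turn_arcl // half_turn_arcr // orbC.
- by rewrite /DP_arc /turn_XY !half_turn_addr.
- by rewrite /DP_arc /turn_XY !(inj_eq (inv_inj (half_turnK _ n_even))).
- by rewrite /DP_arc /turn_XY half_turn_arcl // half_turn_arcr // orbC.
- by rewrite /DP_arc /turn_XY !(inj_eq (inv_inj (half_turnK _ n_even))).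
Qed.

Theorem theorem3 (n k : nat) (n_gt0 : 0 < n) (k_gt0 : 0 < k)
    (n_even : ~~ odd n) (k_lt : k < n./2) :
  isomorphic (DP n k) (DP n (n./2 - k)).
Proof.
(* This bound lets [DP_adjE] discard the guard [a != b], leaving only arcs to compare. *)
have n_gt1 : 1 < n by case: n n_gt0 n_even {k_lt} => [|[|]].
exists (@turn_XY n) => [|a b]; last by rewrite !DP_adjE // turn_XY_arc.
by exists (@turn_XY n); apply: turn_XYK.
Qed.
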